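(* Define, for integers $k \geq 1$, \[ f(k) = \begin{cases} \lceil k/2 \rceil^{-2} & \text{if } k \leq 6,\\ \dfrac{1}{2k-1} & \text{if } k \geq 7.\end{cases}\] (1) For every $\epsilon > 0$ there exists $n_0 \in \mathbb{N}$ such that for every $n \geq n_0$, every integer $k \geq 1$, and all (simple) graphs $G_1, G_2, \ldots, G_k$ on a common set of $n$ vertices, each having at least $(f(k)+\epsilon)\frac{n^2}{2}$ edges, there exists a rainbow path with 3 edges. (2) Moreover, this bound is asymptotically optimal for each $k \geq 1$: for every $k \geq 1$ and every $\delta > 0$, for all sufficiently large $n$ there exist graphs $G_1, \ldots, G_k$ on a common set of $n$ vertices, each having at least $(f(k)-\delta)\frac{n^2}{2}$ edges, with no rainbow path with 3 edges.
   Context: Given graphs $G_1, \ldots, G_k$ on a common vertex set $V$, a rainbow path with 3 edges is a sequence of four distinct vertices $v_0, v_1, v_2, v_3 \in V$ together with three distinct indices $i_1, i_2, i_3 \in [k]$ such that $v_{t-1}v_t$ is an edge of $G_{i_t}$ for $t = 1,2,3$ (i.e. each edge of the path comes from a different graph; an edge may belong to several of the graphs). *)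

(* Defs.v *)
From mathcomp Require Import all_boot all_order all_algebra.
From mathcomp Require Import reals.

Set Implicit Arguments.
Unset Strict Implicit.
Unset Printing Implicit Defensive.

Import Order.TTheory GRing.Theory Num.Theory.

Record sgraph (V : finType) := SGraph {
  adj :> rel V;
  adj_sym : symmetric adj;
  adj_irrefl : irreflexive adj
}.

(* Each edge is the unordered pair of its ends, so it is counted once. *)
Definition edges (V : finType) (G : sgraph V) : {set {set V}} :=
  [set [set p.1; p.2] | p in [pred p : V * V | adj G p.1 p.2]].

Definition has_rainbow_path3 (k : nat) (V : finType) (G : 'I_k -> sgraph V)
    : Prop :=
  exists (v0 v1 v2 v3 : V) (i1 i2 i3 : 'I_k),
    [/\ uniq [:: v0; v1; v2; v3], uniq [:: i1; i2; i3],
        adj (G i1) v0 v1, adj (G i2) v1 v2 & adj (G i3) v2 v3].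

Local Open Scope ring_scope.

(* uphalf k is the ceiling of k / 2. The value at k = 0 (which is 0, by the
   convention 0^-1 = 0) is junk: only k >= 1 is meaningful. *)
Definition f (R : realType) (k : nat) : R :=
  if (k <= 6)%N then (uphalf k)%:R ^- 2 else (2 * k%:R - 1)^-1.

(* Main.v *)
(** Upper bound.  Deleting at most 2n edges from G_i leaves a subgraph H_i, on a
    vertex set T_i, of minimum degree at least 3.  Let C(v) = {i | v in T_i}.
    Without rainbow paths, an edge uv of H_i satisfies C(u) = {i}, or C(v) = {i},
    or C(u) = C(v) = {i, j} for some j: otherwise it is the middle edge of a
    rainbow path.  Let a_i, b_ij and d be the numbers of vertices v with
    C(v) = {i}, with C(v) = {i, j}, and with |C(v)| >= 3; twice the number of
    edges of H_i is at most
      x_i = a_i^2 + 2 a_i (beta_i + d) + sum_j b_ij^2,   beta_i = sum_j b_ij.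
    Rescale so that x_i >= 1 for all i, and let S = d + sum_i (a_i + beta_i / 2)
    be the total weight.  If c <= 1/2 and c^2 + 2cd <= 1 then every summand
    a_i + beta_i / 2 is at least c.  For d >= 3/4, c = sqrt (d^2 + 1) - d gives
    S^2 >= 2k - 1, and for d <= 3/4, c = 1/2 gives S >= d + k/2.  When k is odd and
    d < 1/2, the missing (1 - 2d) / 2 is recovered from the fact that the pairs
    {i, j} with b_ij close to 1 cannot match up all the colours.  So
    S >= uphalf k or S^2 >= 2k - 1, whence f(k) S^2 >= 1.

    Lower bound.  For k <= 6 take uphalf k disjoint cliques, each used by at most
    two colours.  For k >= 7 split the vertices into 2k - 1 equal classes and let
    G_i be the clique on the i-th class, i < k, joined to the last k - 1 classes. *)
Require Import Defs.
From mathcomp Require Import all_boot all_order all_algebra.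
From mathcomp Require Import reals.
From mathcomp Require Import ring lra zify.

Set Implicit Arguments.
Unset Strict Implicit.
Unset Printing Implicit Defensive.

Import Order.TTheory GRing.Theory Num.Theory.
Local Open Scope ring_scope.

(** * The weight optimization *)

(** If [a < w], the second hypothesis on [q] would still hold strictly with [w] in place of [a] and
    [beta ^+ 2] in place of [q]; the bounds on [c] forbid this. *)
Lemma half_weight_ge (R : realFieldType) (a beta d q c : R) :
    0 <= a -> 0 <= beta -> 0 <= d -> q <= beta ^+ 2 ->
    1 <= a ^+ 2 + 2 * a * (beta + d) + q ->
    0 <= c -> c <= 1 / 2 -> c ^+ 2 + 2 * c * d <= 1 ->
  c <= a + beta / 2.
Proof.
move=> a0 b0 d0 qb x1 c0 c1 cd; rewrite leNgt; apply/negP => lt_c.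
set w := c - beta / 2.
have aw : a < w by rewrite /w; lra.
have lt1 : a ^+ 2 + 2 * a * (beta + d) < w ^+ 2 + 2 * w * (beta + d) by nra.
have betaE : beta <= 2 * c by rewrite /w in aw; lra.
suff : w ^+ 2 + 2 * w * (beta + d) + beta ^+ 2 <= 1 by lra.
(* Convex in beta, with values c^2 + 2cd at 0 and 4c^2 at 2c. *)
have -> : w ^+ 2 + 2 * w * (beta + d) + beta ^+ 2
    = c ^+ 2 + 2 * c * d + beta * (c - d) + beta ^+ 2 / 4 by rewrite /w; field.
have c4 : 4 * c ^+ 2 <= 1 by nra.
have [->|cn0] := eqVneq c 0; first by nra.
have cp : 0 < c by rewrite lt_def cn0.
(* Multiplying by [c] clears the denominator of the chord. *)
rewrite -subr_ge0 -(pmulr_rge0 _ cp); nra.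
Qed.

(** The constraint reads [(a + beta + d)^2 >= s^2 + 2 beta d + d^2]. At [d = 0] it gives
    [a + beta >= s], at [d = 1/2] the claim is [a + beta / 2 >= 1/2]; the factor [1 - 2 d]
    interpolates between the two. *)
Lemma excess_ge_sqrt (R : realFieldType) (a beta d q s : R) :
    0 <= a -> 0 <= beta -> 0 <= d -> d <= 1 / 2 -> q <= beta ^+ 2 ->
    1 <= a ^+ 2 + 2 * a * (beta + d) + q ->
    0 <= s -> s ^+ 2 = beta ^+ 2 + 1 - q ->
  (1 - 2 * d) * (s - beta / 2 - 1 / 2) <= a + beta / 2 - 1 / 2.
Proof.
move=> a0 b0 d0 d1 qb x1 s0 sE.
have s1 : 1 <= s by nra.
(* In the first case [beta >= 1], so the right side is nonnegative and the left side is not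
   positive. *)
have [z1|z1] := lerP (2 * s - beta) 1; first by nra.
rewrite leNgt; apply/negP => lt_a.
set t := 2 * s - beta - 2.
have lt_s : a + beta + d < s - d * t by rewrite /t; lra.
have lt_sq : (a + beta + d) ^+ 2 < (s - d * t) ^+ 2.
  by rewrite ltr_pXn2r // nnegrE; lra.
have key : d * (t ^+ 2 - 1) <= 2 * (2 * s - beta) * (s - 1).
  have [z3|z3] := lerP (2 * s - beta) 3.
    have : t ^+ 2 - 1 <= 0 by rewrite /t; nra.
    by nra.
  have : t ^+ 2 - 1 <= 4 * (2 * s - beta) * (s - 1) by rewrite /t; nra.
  have : 0 <= t ^+ 2 - 1 by rewrite /t; nra.
  by nra.
have : (s - d * t) ^+ 2 <= s ^+ 2 + 2 * beta * d + d ^+ 2.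
  rewrite -subr_ge0.
  have -> : s ^+ 2 + 2 * beta * d + d ^+ 2 - (s - d * t) ^+ 2
     = d * (2 * (2 * s - beta) * (s - 1) - d * (t ^+ 2 - 1)) by rewrite /t; ring.
  by rewrite mulr_ge0 // subr_ge0.
by nra.
Qed.

(** * Excess of a single row *)

Lemma sqrt_ge_large_max (R : realFieldType) (beta q m s : R) :
    4 / 7 <= m -> m <= beta -> q <= m * beta -> q <= m ^+ 2 + (beta - m) ^+ 2 ->
    0 <= s -> s ^+ 2 = beta ^+ 2 + 1 - q ->
  (1 - m) / 2 <= s - beta / 2 - 1 / 2.
Proof.
move=> m47 mb q1 q2 s0 sE.
suff : 1 + (beta - m) / 2 <= s by lra.
suff : (1 + (beta - m) / 2) ^+ 2 <= s ^+ 2.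
  by rewrite ler_pXn2r // nnegrE; lra.
(* Put [r = beta - m]. If [r <= m], then [s^2 >= 1 + 2 m r], and [1 + r / 4 <= 2 m] is enough. If
   [r > m], then [s^2 >= 1 + (m + r) r], and [1 <= m + 3 r / 4] is enough. Both follow from
   [m >= 4/7], the origin of this threshold. *)
have [rm|rm] := lerP (beta - m) m; nra.
Qed.

(* As a function of [m], the minimum over [beta] of
   [sqrt (beta^2 + 1 - m beta) - beta / 2 - 1 / 2] is
   [sqrt 3 / 4 * sqrt (4 - m^2) - m / 4 - 1 / 2], which lies just above the line. *)
Lemma sqrt_ge_small_max (R : realFieldType) (beta q m s : R) :
    0 <= m -> m <= 4 / 7 -> 0 <= beta -> q <= m * beta ->
    0 <= s -> s ^+ 2 = beta ^+ 2 + 1 - q ->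
  36 / 100 - 31 / 100 * m <= s - beta / 2 - 1 / 2.
Proof.
move=> m0 m47 b0 q1 s0 sE.
suff : beta / 2 + 86 / 100 - 31 / 100 * m <= s by lra.
suff : (beta / 2 + 86 / 100 - 31 / 100 * m) ^+ 2 <= s ^+ 2.
  by rewrite ler_pXn2r // nnegrE; lra.
rewrite sE -subr_ge0.
(* The centre of the square minimizes [beta^2 + 1 - m beta - (beta / 2 + 86/100 - 31/100 m)^2] in
   [beta]. *)
have sq : 0 <= (beta - 2 / 3 * (86 / 100 + 69 / 100 * m)) ^+ 2 by apply: sqr_ge0.
have : 0 <= m * (4 / 7 - m) by nra.
nra.
Qed.

(* The least possible value of [a i + (\sum_j b i j) / 2 - 1 / 2] when [d = 0]. *)
Definition excess (R : rcfType) (k : nat) (b : 'I_k -> 'I_k -> R) (i : 'I_k) : R :=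
  let beta := \sum_j b i j in
  let s := Num.sqrt (beta ^+ 2 + 1 - \sum_j b i j ^+ 2) in
  Num.max (s - beta / 2 - 1 / 2) ((beta - 1) / 2).

Lemma sum_sqr_le (R : realFieldType) (I : finType) (P : pred I) (F : I -> R) :
  (forall i, 0 <= F i) ->
  \sum_(i | P i) F i ^+ 2 <= (\sum_(i | P i) F i) ^+ 2.
Proof.
move=> F0; rewrite [leRHS]expr2 mulr_suml; apply: ler_sum => i Pi.
rewrite expr2 ler_wpM2l // (bigD1 i) //= lerDl.
by apply: sumr_ge0.
Qed.

Lemma sqrt_row_spec (R : rcfType) (I : finType) (F : I -> R) :
  (forall i, 0 <= F i) ->
  let beta := \sum_i F i in let q := \sum_i F i ^+ 2 in
  Num.sqrt (beta ^+ 2 + 1 - q) ^+ 2 = beta ^+ 2 + 1 - q.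
Proof.
move=> F0 beta q; apply: sqr_sqrtr.
by have := sum_sqr_le predT F0; rewrite -/beta -/q; lra.
Qed.

(** For the second term of the maximum in [excess], [a >= 0] suffices when [beta >= 1]; otherwise
    that term is negative, while the right side is nonnegative by [half_weight_ge] with
    [c = 1/2]. *)
Lemma half_weight_excess (R : rcfType) (k : nat) (a : R)
    (b : 'I_k -> 'I_k -> R) (d : R) (i : 'I_k) :
    0 <= a -> (forall j, 0 <= b i j) -> 0 <= d -> d <= 1 / 2 ->
    1 <= a ^+ 2 + 2 * a * (\sum_j b i j + d) + \sum_j b i j ^+ 2 ->
  (1 - 2 * d) * excess b i <= a + (\sum_j b i j) / 2 - 1 / 2.
Proof.
move=> a0 b0 d0 d1 x1.
have qb := sum_sqr_le predT b0.
have beta0 : 0 <= \sum_j b i j by apply: sumr_ge0.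
have h1 := excess_ge_sqrt a0 beta0 d0 d1 qb x1 (sqrtr_ge0 _) (sqrt_row_spec b0).
have h2 := half_weight_ge a0 beta0 d0 qb x1 (c := 1 / 2).
have {}h2 : 1 / 2 <= a + (\sum_j b i j) / 2 by apply: h2; lra.
rewrite /excess.
set s := Num.sqrt _ in h1 *; set beta := \sum_j b i j in beta0 h1 h2 *.
by case: (leP (s - beta / 2 - 1 / 2) ((beta - 1) / 2)) => _ //; nra.
Qed.

Lemma excess_ge_beta (R : rcfType) (k : nat) (b : 'I_k -> 'I_k -> R) i :
  (\sum_j b i j - 1) / 2 <= excess b i.
Proof. by rewrite /excess le_max lexx orbT. Qed.

Lemma excess_ge0 (R : rcfType) (k : nat) (b : 'I_k -> 'I_k -> R) i :
  (forall j, 0 <= b i j) -> 0 <= excess b i.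
Proof.
move=> b0; have sE := sqrt_row_spec b0.
have qb := sum_sqr_le predT b0.
rewrite /excess; set s := Num.sqrt _ in sE *; set beta := \sum_j b i j in sE qb *.
have s0 : 0 <= s by apply: sqrtr_ge0.
have s1 : 1 <= s.
  rewrite -(ler_pXn2r (n := 2)) ?nnegrE // sE expr1n; move: qb => /=; lra.
rewrite le_max; have [h|h] := lerP 0 ((beta - 1) / 2); first by rewrite orbT.
by rewrite orbF; lra.
Qed.

Lemma excess_ge_max (R : rcfType) (k : nat) (b : 'I_k -> 'I_k -> R) i j0 :
    (forall j, 0 <= b i j) -> (forall j, b i j <= b i j0) ->
  (4 / 7 <= b i j0 -> (1 - b i j0) / 2 <= excess b i) /\
  (b i j0 <= 4 / 7 -> 36 / 100 - 31 / 100 * b i j0 <= excess b i).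
Proof.
move=> b0 bmax; have sE := sqrt_row_spec b0.
have beta0 : 0 <= \sum_j b i j by apply: sumr_ge0.
have s0 := sqrtr_ge0 ((\sum_j b i j) ^+ 2 + 1 - \sum_j b i j ^+ 2).
have q1 : \sum_j b i j ^+ 2 <= b i j0 * \sum_j b i j.
  by rewrite mulr_sumr; apply: ler_sum => j _; rewrite expr2 ler_wpM2r.
have mb : b i j0 <= \sum_j b i j.
  by rewrite (bigD1 j0) //= lerDl; apply: sumr_ge0.
have q2 : \sum_j b i j ^+ 2 <= b i j0 ^+ 2 + (\sum_j b i j - b i j0) ^+ 2.
  rewrite (bigD1 j0) //= lerD2l [X in X - _](bigD1 j0) //= [X in X - _]addrC addrK.
  exact: sum_sqr_le.
split=> hm; rewrite /excess le_max; apply/orP; left.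
  exact: sqrt_ge_large_max hm mb q1 q2 s0 sE.
exact: sqrt_ge_small_max (b0 _) hm beta0 q1 s0 sE.
Qed.

Lemma excess_row0 (R : rcfType) (k : nat) (b : 'I_k -> 'I_k -> R) i :
  (forall j, b i j = 0) -> 1 / 2 <= excess b i.
Proof.
move=> b0; rewrite /excess.
have -> : \sum_j b i j = 0 by apply: big1.
have -> : \sum_j b i j ^+ 2 = 0 by apply: big1 => j _; rewrite b0 expr0n.
by rewrite expr0n /= add0r subr0 sqrtr1 le_max; apply/orP; left; lra.
Qed.

(** The left side is twice the first term of [excess] for a row whose only entries are [b i l] and
    [b i j]. The other entries, of sum [rho], can only increase that term. *)
Lemma excess_ge_two (R : rcfType) (k : nat) (b : 'I_k -> 'I_k -> R) i j l :
    (forall j, 0 <= b i j) -> (forall j, b i j <= b i l) -> 4 / 7 <= b i l ->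
    j != l ->
  2 * Num.sqrt (1 + 2 * b i l * b i j) - b i l - b i j - 1 <= 2 * excess b i.
Proof.
move=> b0 bmax p47 jl; have := sqrt_row_spec b0 => /=.
have : Num.sqrt ((\sum_j b i j) ^+ 2 + 1 - \sum_j b i j ^+ 2)
    - (\sum_j b i j) / 2 - 1 / 2 <= excess b i.
  by rewrite /excess le_max lexx.
have := sqrtr_ge0 ((\sum_j b i j) ^+ 2 + 1 - \sum_j b i j ^+ 2).
move: (Num.sqrt _) => s s0 Es sE.
have rho0 : 0 <= \sum_(h | (h != l) && (h != j)) b i h by apply: sumr_ge0.
have q1 := sum_sqr_le (fun h => (h != l) && (h != j)) b0.
have q2 : \sum_(h | (h != l) && (h != j)) b i h ^+ 2
    <= b i l * \sum_(h | (h != l) && (h != j)) b i h.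
  by rewrite mulr_sumr; apply: ler_sum => h _; rewrite expr2 ler_wpM2r.
move: sE Es.
rewrite (bigD1 l) //= (bigD1 j) //= [\sum_h b i h ^+ 2](bigD1 l) //=.
rewrite [\sum_(h | h != l) b i h ^+ 2](bigD1 j) //=.
set rho := \sum_(h | _) b i h in rho0 q1 q2 *.
set q' := \sum_(h | _) b i h ^+ 2 in q1 q2 *.
move: (b i l) (b i j) (b0 l) (b0 j) p47 q2 => p x p0 x0 p47 q2 sE Es.
have t0 : 0 <= 1 + 2 * p * x by nra.
set t := Num.sqrt (1 + 2 * p * x).
have t_ge0 : 0 <= t by apply: sqrtr_ge0.
have tE : t ^+ 2 = 1 + 2 * p * x by rewrite sqr_sqrtr.
suff : t + rho / 2 <= s by lra.
(* As [p >= 4/7], [7/4 p >= 1]. This bound leaves room for [rho / 4]: [7/4 p + rho / 4] is at most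
   [2 p] if [rho <= p], and at most [p + rho] otherwise. *)
have tle : t <= 7 / 4 * p + 2 * x.
  rewrite -(ler_pXn2r (n := 2)) ?nnegrE ?tE //; last by lra.
  by nra.
rewrite -(ler_pXn2r (n := 2)) ?nnegrE //; last by lra.
have -> : (t + rho / 2) ^+ 2 = 1 + 2 * p * x + rho * (t + rho / 4).
  by rewrite -tE; field.
have -> : s ^+ 2 = 1 + 2 * p * x + rho * (2 * (p + x)) + (rho ^+ 2 - q').
  by rewrite sE; ring.
suff : rho * (t + rho / 4) <= rho * (2 * (p + x)) + (rho ^+ 2 - q') by lra.
have [rp|rp] := lerP rho p.
  have : rho * (t + rho / 4) <= rho * (2 * (p + x)) by rewrite ler_wpM2l //; lra.
  by lra.
have : rho * (t + rho / 4) <= rho * (2 * (p + x) + rho - p).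
  by rewrite ler_wpM2l //; lra.
by lra.
Qed.

(** * Matched rows and an odd number of colours *)

(** Here [ej] and [el] stand for twice the excesses of two rows whose common maximum is [p], and
    [x], [y] for their entries at a third colour. For large [p] the linear bound on [ej] is used,
    otherwise the square root bounds on both; since [t] is concave in [y], only [y = 0] and [y = x]
    then matter. *)
Lemma pair_excess_wlog (R : rcfType) (p x y ej el : R) :
    4 / 7 <= p -> 0 <= y -> y <= x -> x <= 4 / 7 ->
    x + p - 1 <= ej -> 2 * Num.sqrt (1 + 2 * p * x) - p - x - 1 <= ej ->
    2 * Num.sqrt (1 + 2 * p * y) - p - y - 1 <= el ->
  x + y - 7 / 5 * x * y <= ej + el.
Proof.
move=> p47 y0 yx x47 ej1 ej2 el2.
set s := Num.sqrt (1 + 2 * p * x) in ej2.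
set t := Num.sqrt (1 + 2 * p * y) in el2.
have px0 : 0 <= p * x by nra.
have py0 : 0 <= p * y by nra.
have s0 : 0 <= s by apply: sqrtr_ge0.
have t0 : 0 <= t by apply: sqrtr_ge0.
have sE : s ^+ 2 = 1 + 2 * p * x by rewrite sqr_sqrtr; lra.
have tE : t ^+ 2 = 1 + 2 * p * y by rewrite sqr_sqrtr; lra.
set u := 1 - 7 / 10 * x.
have u0 : 0 < u by rewrite /u; lra.
have [hp|hp] := lerP (2 * u + x * u ^+ 2) (2 * p).
  suff : 1 + y * u <= t by rewrite /u; lra.
  rewrite -(ler_pXn2r (n := 2)) ?nnegrE ?tE //; last by nra.
  have : y * (y * u ^+ 2) <= y * (x * u ^+ 2).
    by rewrite ler_wpM2l // ler_wpM2r // sqr_ge0.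
  have : y * (2 * u + x * u ^+ 2) <= y * (2 * p) by rewrite ler_wpM2l.
  by lra.
have s1 : 1 <= s by nra.
(* This is the inequality needed at [y = x], where [t = s]. *)
have key : (1 + p) / 2 + x - 7 / 20 * x ^+ 2 <= s.
  rewrite -(ler_pXn2r (n := 2)) ?nnegrE ?sE //; last by nra.
  (* The difference is convex in p on [4/7, P]: it lies below its chord. *)
  set P := u + x * u ^+ 2 / 2.
  have pP : p < P by rewrite /P; lra.
  have chord : ((1 + p) / 2 + x - 7 / 20 * x ^+ 2) ^+ 2 - (1 + 2 * p * x)
    = ((p - 4 / 7) * (((1 + P) / 2 + x - 7 / 20 * x ^+ 2) ^+ 2 - (1 + 2 * P * x))
      + (P - p) * ((11 / 14 + x - 7 / 20 * x ^+ 2) ^+ 2 - (1 + 8 / 7 * x)))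
        / (P - 4 / 7) - (p - 4 / 7) * (P - p) / 4.
    by field; apply/lt0r_neq0; lra.
  have endP : ((1 + P) / 2 + x - 7 / 20 * x ^+ 2) ^+ 2 - (1 + 2 * P * x) <= 0.
    have x0 : 0 <= x by lra.
    pose h := 1 / 5 + 7 / 10 * x - 49 / 200 * x ^+ 2.
    pose e := 9 / 10 - 7 / 10 * x + 49 / 400 * x ^+ 2.
    have -> : ((1 + P) / 2 + x - 7 / 20 * x ^+ 2) ^+ 2 - (1 + 2 * P * x)
      = - (x * (h * (1 - 2 * x) + 7 / 10 * x - x * e ^+ 2)).
      by rewrite /P /u /h /e; field.
    have x2 : x ^+ 2 <= 4 / 7 * x by nra.
    have e0 : 0 <= e by rewrite /e; nra.
    have e1 : e <= 9 / 10 - 63 / 100 * x by rewrite /e; nra.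
    have e2 : e ^+ 2 <= (9 / 10 - 63 / 100 * x) ^+ 2 by rewrite ler_pXn2r ?nnegrE //; lra.
    have xe : x * e ^+ 2 <= x * (9 / 10 - 63 / 100 * x) ^+ 2 by rewrite ler_wpM2l.
    rewrite oppr_le0 mulr_ge0 // subr_ge0; apply: (le_trans xe).
    have x3 : 0 <= x ^+ 3 by rewrite exprn_ge0.
    by rewrite /h; lra.
  have end47 : (11 / 14 + x - 7 / 20 * x ^+ 2) ^+ 2 - (1 + 8 / 7 * x) <= 0 by nra.
  rewrite -subr_le0 chord subr_le0.
  have P47 : 0 < P - 4 / 7 by lra.
  apply: (@le_trans _ _ 0); last by rewrite divr_ge0 // mulr_ge0 //; lra.
  by rewrite pmulr_lle0 ?invr_gt0 //; nra.
(* The chord of [t] as a function of [y], which is [1] at [y = 0] and [s] at [y = x]. *)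
have tle : x + y * (s - 1) <= x * t.
  have x0 : 0 <= x by lra.
  rewrite -(ler_pXn2r (n := 2)) ?nnegrE //; [|by nra|by nra].
  rewrite [leRHS]exprMn tE -subr_ge0.
  have -> : x ^+ 2 * (1 + 2 * p * y) - (x + y * (s - 1)) ^+ 2
      = y * (x - y) * (s - 1) ^+ 2 + x * y * (1 + 2 * p * x - s ^+ 2) by ring.
  rewrite sE subrr mulr0 addr0 mulr_ge0 ?sqr_ge0 //; nra.
(* The inequality needed at [y = 0], where [t = 1]. *)
have A0 : 0 <= s - p - x.
  have : 7 / 10 * x ^+ 2 <= 1 - p by move: hp; rewrite /u; nra.
  by lra.
have [x_eq0|xn0] := eqVneq x 0.
  have y_eq0 : y = 0 by lra.
  have : 1 <= t by nra.
  by move: hp s1 ej2 el2; rewrite /u x_eq0 y_eq0; lra.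
have x0 : 0 < x by lra.
suff : 0 <= x * (s + t - (1 + p + x + y - 7 / 10 * x * y)).
  by rewrite pmulr_rge0 //; lra.
have : 0 <= (x - y) * (s - p - x) by rewrite mulr_ge0 //; lra.
have : 0 <= y * (2 * s - 1 - p - 2 * x + 7 / 10 * x ^+ 2) by rewrite mulr_ge0 //; lra.
by lra.
Qed.

(** Without fixed points, [p] exchanges the indices that it raises with those that it lowers, so [k]
    is even. *)
Lemma odd_involution_fixpoint (k : nat) (p : 'I_k -> 'I_k) :
  odd k -> involutive p -> exists i, p i = i.
Proof.
move=> odd_k pK.
have [/existsP[i /eqP pi]|] := boolP [exists i, p i == i]; first by exists i.
rewrite negb_exists => /forallP nofix.
pose A := [set i : 'I_k | (i < p i)%N].
have imA : p @: A = ~: A.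
  apply/setP => i; rewrite !inE; apply/imsetP/idP => [[j + ->]|].
    by rewrite inE pK -leqNgt => /ltnW.
  rewrite -leqNgt leq_eqVlt val_eqE (negbTE (nofix i)) /= => lt_i.
  by exists (p i); rewrite ?pK // inE pK.
have := cardsC A; rewrite -imA card_imset; last exact: inv_inj.
by rewrite card_ord addnn => kE; rewrite -kE odd_double in odd_k.
Qed.

Lemma pair_excess (R : rcfType) (k : nat) (b : 'I_k -> 'I_k -> R) i j l :
    (forall i j, 0 <= b i j) -> (forall i j, b i j = b j i) ->
    (forall h, b j h <= b j l) -> (forall h, b l h <= b l j) ->
    i != j -> i != l -> 4 / 7 <= b j l -> b i j <= 4 / 7 -> b i l <= 4 / 7 ->
  (b i j + b i l - 7 / 5 * b i j * b i l) / 2 <= excess b j + excess b l.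
Proof.
move=> b0 bC bj bl ij il p47.
have p47' : 4 / 7 <= b l j by rewrite bC.
have := excess_ge_two (b := b) (b0 j) bj p47 il.
have := excess_ge_two (b := b) (b0 l) bl p47' ij.
have sub2 h h' : h' != i -> b i h + b h h' - 1 <= 2 * excess b h.
  move=> nh; have := excess_ge_beta b h.
  rewrite (bigD1 i) //= (bigD1 h') //= (bC i h).
  have : 0 <= \sum_(x < k | (x != i) && (x != h')) b h x by apply: sumr_ge0.
  by lra.
have := sub2 j l; have := sub2 l j; rewrite 2!(eq_sym _ i) => /(_ ij) + /(_ il).
rewrite (bC l j) (bC j i) (bC l i) => El1 Ej1 El2 Ej2 x47 y47.
have [xy|/ltW xy] := lerP (b i l) (b i j).
  by have := pair_excess_wlog p47 (b0 i l) xy x47 Ej1 Ej2 El2; lra.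
by have := pair_excess_wlog p47 (b0 i j) xy y47 El1 El2 Ej2; lra.
Qed.

Lemma sum_involution (R : realFieldType) (k : nat) (p : 'I_k -> 'I_k) i (F : 'I_k -> R) :
  involutive p -> p i = i ->
  \sum_(j | j != i) F j = (\sum_(j | j != i) (F j + F (p j))) / 2.
Proof.
move=> pK pi; rewrite big_split /=.
have -> : \sum_(j | j != i) F (p j) = \sum_(j | j != i) F j.
  rewrite [RHS](reindex_inj (inv_inj pK)) /=.
  by apply: eq_bigl => j; rewrite -{2}pi (inj_eq (inv_inj pK)).
by field.
Qed.

(** The term [- beta / 2] in the excess of row [i] is compensated by the matched pairs up to
    [7/20 w], where [w] sums the products of the entries of row [i] at matched colours. It remains
    that [s >= 1 + 7/20 w], which follows from [s^2 >= 1 + w] and [w <= 2]. *)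
Lemma sum_excess_one_unmatched (R : rcfType) (k : nat) (b : 'I_k -> 'I_k -> R)
    (i : 'I_k) (p : 'I_k -> 'I_k) :
    (forall i j, 0 <= b i j) -> (forall i j, b i j = b j i) ->
    b i i = 0 -> (forall j, b i j <= 4 / 7) -> involutive p -> p i = i ->
    (forall j, j != i -> [/\ p j != j, forall h, b j h <= b j (p j)
                           & 4 / 7 <= b j (p j)]) ->
  1 / 2 <= \sum_j excess b j.
Proof.
move=> b0 bC bii b47 pK pi bp.
have E0 j : 0 <= excess b j by apply: excess_ge0.
set beta := \sum_j b i j.
have [beta2|beta2] := lerP 2 beta.
  have := excess_ge_beta b i; rewrite -/beta (bigD1 i) //= => h.
  have : 0 <= \sum_(j | j != i) excess b j by apply: sumr_ge0.
  by lra.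
set w := \sum_j b i j * b i (p j).
have Epairs : (beta - 7 / 10 * w) / 2 <= \sum_(j | j != i) excess b j.
  have betaE : beta = (\sum_(j | j != i) (b i j + b i (p j))) / 2.
    by rewrite -(sum_involution _ pK pi) /beta (bigD1 i) //= bii add0r.
  have : \sum_(j | j != i) (b i j + b i (p j) - 7 / 5 * (b i j * b i (p j))) / 2
      <= \sum_(j | j != i) (excess b j + excess b (p j)).
    apply: ler_sum => j ji; have [pjj jmax p47] := bp j ji.
    have pji : p j != i by rewrite -pi (inj_eq (inv_inj pK)).
    have [_ pjmax _] := bp (p j) pji.
    rewrite pK in pjmax; rewrite mulrA.
    by apply: pair_excess => //; rewrite eq_sym.
  rewrite (sum_involution (excess b) pK pi) -mulr_suml sumrB -mulr_sumr.
  have -> : w = \sum_(j | j != i) b i j * b i (p j).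
    by rewrite /w (bigD1 i) //= bii mul0r add0r.
  by lra.
have qw : w <= \sum_j b i j ^+ 2.
  have : \sum_j b i (p j) ^+ 2 = \sum_j b i j ^+ 2.
    by rewrite [RHS](reindex_inj (inv_inj pK)).
  have : 0 <= \sum_j (b i j - b i (p j)) ^+ 2 by apply: sumr_ge0 => j _; apply: sqr_ge0.
  have -> : \sum_j (b i j - b i (p j)) ^+ 2
     = \sum_j b i j ^+ 2 + \sum_j b i (p j) ^+ 2 - 2 * w.
    by rewrite /w mulr_sumr -big_split -sumrB /=; apply: eq_bigr => j _; ring.
  by lra.
(* For [j != i], the products at [(j, j)] and [(j, p j)] are distinct terms of the expanded square.
   With [qw] this gives [2 w <= beta^2 < 4]. *)
have beta_qw : \sum_j b i j ^+ 2 + w <= beta ^+ 2.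
  rewrite -big_split /= expr2 {1}/beta mulr_suml; apply: ler_sum => j _.
  rewrite expr2 -mulrDr ler_wpM2l //.
  have [->|ji] := eqVneq j i.
    by rewrite pi bii addr0; apply: sumr_ge0.
  have [pjj _ _] := bp j ji.
  rewrite /beta (bigD1 j) //= lerD2l (bigD1 (p j)) //= lerDl.
  by apply: sumr_ge0.
have w0 : 0 <= w by apply: sumr_ge0 => j _; apply: mulr_ge0.
have beta0 : 0 <= beta by apply: sumr_ge0.
have sE := sqrt_row_spec (b0 i).
have : Num.sqrt (beta ^+ 2 + 1 - \sum_j b i j ^+ 2) - beta / 2 - 1 / 2 <= excess b i.
  by rewrite /excess le_max lexx.
have s0 := sqrtr_ge0 (beta ^+ 2 + 1 - \sum_j b i j ^+ 2).
move: sE s0; rewrite -/beta /=; move: (Num.sqrt _) => s sE s0 Ei.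
have w2 : w <= 2 by nra.
suff : 1 + 7 / 20 * w <= s by rewrite (bigD1 i) //=; lra.
rewrite -(ler_pXn2r (n := 2)) ?nnegrE ?sE //; [by nra|by lra].
Qed.

Lemma sum_ge_seq (R : realFieldType) (I : finType) (F : I -> R) (s : seq I) :
  (forall i, 0 <= F i) -> uniq s -> \sum_(i <- s) F i <= \sum_i F i.
Proof.
move=> F0 s_uniq; rewrite big_uniq // [leRHS](bigID (mem s)) /= lerDl.
by apply: sumr_ge0.
Qed.

(** Row maxima do not decrease along [i], [j], [l]. Row [j] contains both [b i j] and [b j l], so
    its excess makes up for what large maxima take from the bounds on rows [i] and [l]. The
    exception is a small maximum in row [i] next to a strongly matched pair [j], [l]. *)
Lemma excess_unmatched (R : rcfType) (k : nat) (b : 'I_k -> 'I_k -> R)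
    (p : 'I_k -> 'I_k) (i : 'I_k) :
    (forall i j, 0 <= b i j) -> (forall i j, b i j = b j i) ->
    (forall i j, b i j <= b i (p i)) -> (forall i, p i != i) -> p (p i) != i ->
    let j := p i in let l := p j in
  1 / 2 <= excess b i + excess b j + excess b l \/
  [/\ b i j < 4 / 7, p l = j
    & 36 / 100 <= excess b i + excess b j + excess b l].
Proof.
move=> b0 bC pmax pn ppi j l.
have Ei := excess_ge_max (b0 i) (pmax i).
have Ej := excess_ge_max (b0 j) (pmax j).
have El := excess_ge_max (b0 l) (pmax l).
have mp : b i j <= b j l by rewrite bC pmax.
have pr : b j l <= b l (p l) by rewrite bC pmax.
have il : i != l by rewrite eq_sym.
have ij : i != j by rewrite eq_sym pn.
have jl : j != l by rewrite eq_sym pn.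
have m0 := b0 i j.
have sub2 x y z : y != z -> (b x y + b x z - 1) / 2 <= excess b x.
  move=> nyz; have := excess_ge_beta b x.
  rewrite (bigD1 y) //= (bigD1 z) //=; last by rewrite eq_sym.
  have : 0 <= \sum_(h < k | (h != y) && (h != z)) b x h by apply: sumr_ge0.
  by lra.
have Ej' : (b i j + b j l - 1) / 2 <= excess b j.
  by rewrite (bC i j); apply: sub2.
have Ej0 : 0 <= excess b j by apply: excess_ge0.
have El0 : 0 <= excess b l by apply: excess_ge0.
rewrite -/j -/l in Ei Ej.
have [plj|plj] := eqVneq (p l) j; last first.
  left.
  (* When [b l (p l) >= 4/7], this is the mean of the bounds [(b j l + b l (p l) - 1) / 2] and
     [(1 - b l (p l)) / 2]. *)
  have El' : b j l / 4 <= excess b l.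
    have : (b j l + b l (p l) - 1) / 2 <= excess b l.
      by rewrite (bC j l); apply: sub2; rewrite eq_sym.
    have [hl|/ltW hl] := lerP (4 / 7) (b l (p l)).
      by have := El.1 hl; lra.
    by have := El.2 hl; lra.
  have [hj|/ltW hj] := lerP (4 / 7) (b j l); last first.
    by have := Ej.2 hj; have := Ei.2 (le_trans mp hj); lra.
  have := Ej.1 hj.
  have [hi|/ltW hi] := lerP (4 / 7) (b i j).
    by have := Ei.1 hi; lra.
  by have := Ei.2 hi; lra.
rewrite plj (bC l j) in El.
have [hj|/ltW hj] := lerP (4 / 7) (b j l); last first.
  by left; have := Ej.2 hj; have := El.2 hj; have := Ei.2 (le_trans mp hj); lra.
have := El.1 hj.
have [hi|hi] := lerP (4 / 7) (b i j).
  by left; have := Ei.1 hi; lra.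
by right; split => //; have := Ei.2 (ltW hi); lra.
Qed.

(* Let [p i] be a position of the maximum of row [i]; as [k] is odd, [p] cannot
   match up all indices. *)
Lemma sum_excess_odd (R : rcfType) (k : nat) (b : 'I_k -> 'I_k -> R) :
    odd k -> (forall i j, 0 <= b i j) -> (forall i j, b i j = b j i) ->
    (forall i, b i i = 0) ->
  1 / 2 <= \sum_i excess b i.
Proof.
move=> odd_k b0 bC bD.
have E0 i : 0 <= excess b i by apply: excess_ge0.
have sumE := sum_ge_seq E0.
have k0 : (0 < k)%N by case: (k) odd_k.
have [p pmax] : exists p, forall i j, b i j <= b i (p i).
  exists (fun i => [arg max_(j > Ordinal k0) b i j]%O) => i j.
  by case: arg_maxP => // j' _; apply.
(* The diagonal is zero, so a row with its maximum there vanishes and has excess at least [1/2] by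
   itself. *)
have [/existsP[i /eqP pi]|] := boolP [exists i, p i == i].
  have := sumE [:: i] isT; rewrite big_seq1; apply: le_trans.
  apply: excess_row0 => j; apply/le_anti.
  by rewrite b0 andbT -(bD i) -{3}pi pmax.
rewrite negb_exists => /forallP pn.
have pn' h : h != p h by rewrite eq_sym.
have [/existsP[i ppi]|] := boolP [exists i, p (p i) != i]; last first.
  rewrite negb_exists => /forallP invp.
  have [i|i pi] := @odd_involution_fixpoint k p odd_k.
    by have /negPn/eqP := invp i.
  by have := pn i; rewrite pi eqxx.
have sum3 h : p (p h) != h -> excess b h + excess b (p h) + excess b (p (p h)) <= \sum_i excess b i.
  move=> pph; have := sumE [:: h; p h; p (p h)].
  rewrite unlock /= addr0 addrA; apply.
  by rewrite !inE negb_or andbT !pn' (eq_sym h (p _)) pph.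
(* Three such rows, or one together with the [36/100] of [excess_unmatched], give [54/100]. *)
have small h : b h (p h) <= 4 / 7 -> 18 / 100 <= excess b h.
  by move=> mh; have := (excess_ge_max (b0 h) (pmax h)).2 mh; lra.
have [|[mi ppj Ei]] := excess_unmatched b0 bC pmax pn ppi.
  by move/le_trans; apply; exact: sum3.
(* A second unmatched row [h] in the exceptional case is small, and is distinct from [i], [p i] and
   [p (p i)]. *)
have [/existsP[h /andP[hi pph]]|] := boolP [exists h, (h != i) && (p (p h) != h)].
  have [|[mh _ _]] := excess_unmatched b0 bC pmax pn pph.
    by move/le_trans; apply; exact: sum3.
  have := sumE [:: i; p i; p (p i); h].
  have ppih : p (p i) != h.
    by apply: contraNneq pph => <-; rewrite !ppj.
  have pih : p i != h by apply: contraNneq pph => <-; rewrite ppj.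
  rewrite unlock /= addr0 !inE !negb_or !pn' (eq_sym i (p (p i))) ppi pih ppih.
  rewrite eq_sym hi /= => /(_ isT).
  by have := small h (ltW mh); lra.
rewrite negb_exists => /forallP match_p.
have ppK h : h != i -> p (p h) = h.
  by move=> hi; apply/eqP; have := match_p h; rewrite hi /= negbK.
have pi h : h != i -> p h != i.
  move=> hi; apply: contraNneq ppi => phi.
  have pih : p i = h by rewrite -phi ppK.
  by rewrite pih phi.
have [/existsP[h /andP[hi mh]]|] := boolP [exists h, (h != i) && (b h (p h) <= 4 / 7)].
  have := sumE [:: i; h; p h].
  rewrite unlock /= addr0 !inE !negb_or !(eq_sym i) hi pi // pn' /= => /(_ isT).
  have := small i (ltW mi); have := small h mh; have := small (p h).
  by rewrite ppK // bC => /(_ mh); lra.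
rewrite negb_exists => /forallP big_p.
(* All rows but [i] are now strongly matched; sending [i] to itself turns [p] into an involution. *)
pose p' h := if h == i then i else p h.
apply: (@sum_excess_one_unmatched _ _ b i p') => //.
- by move=> j; apply: le_trans (pmax i j) (ltW mi).
- move=> h; rewrite /p'; have [->|hi] := eqVneq h i; first by rewrite eqxx.
  by rewrite (negbTE (pi h hi)) ppK.
- by rewrite /p' eqxx.
move=> h hi; rewrite /p' (negbTE hi); split => //.
by have := big_p h; rewrite hi /= -ltNge => /ltW.
Qed.

(** * Total weight and its comparison with [f] *)

Lemma natr_uphalf (R : realFieldType) (k : nat) :
  (uphalf k)%:R = (k%:R + (odd k)%:R) / 2 :> R.
Proof.
have -> : k%:R = (odd k)%:R + 2 * (k./2)%:R :> R.
  by rewrite -{1}(odd_double_half k) natrD -muln2 natrM mulrC.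
by rewrite uphalf_half natrD; field.
Qed.

Lemma total_weight_ge (R : rcfType) (k : nat) (a : 'I_k -> R)
    (b : 'I_k -> 'I_k -> R) (d : R) :
    (forall i, 0 <= a i) -> (forall i j, 0 <= b i j) -> 0 <= d ->
    (forall i j, b i j = b j i) -> (forall i, b i i = 0) ->
    (forall i, 1 <= a i ^+ 2 + 2 * a i * (\sum_j b i j + d) + \sum_j b i j ^+ 2) ->
  let S := d + \sum_i (a i + (\sum_j b i j) / 2) in
  (uphalf k)%:R <= S \/ 2 * k%:R - 1 <= S ^+ 2.
Proof.
move=> a0 b0 d0 bC bD x1 S.
have halfS c : 0 <= c -> c <= 1 / 2 -> c ^+ 2 + 2 * c * d <= 1 -> d + k%:R * c <= S.
  move=> c0 c1 cd; rewrite lerD2l mulr_natl.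
  have -> : c *+ k = \sum_(i < k) c by rewrite sumr_const card_ord.
  apply: ler_sum => i _; apply: half_weight_ge (x1 i) c0 c1 cd => //.
    by apply: sumr_ge0.
  exact: sum_sqr_le.
have [d34|d34] := lerP d (3 / 4).
  left; rewrite natr_uphalf.
  have hS : d + k%:R * (1 / 2) <= S by apply: halfS; lra.
  case odd_k: (odd k); last by rewrite addr0; lra.
  have -> : (nat_of_bool true)%:R = 1 :> R by [].
  have [d12|d12] := lerP (1 / 2) d; first by lra.
  have Eodd := sum_excess_odd odd_k b0 bC bD.
  have : (1 - 2 * d) * \sum_i excess b i <= \sum_i (a i + (\sum_j b i j) / 2) - k%:R / 2.
    rewrite mulr_sumr.
    have -> : k%:R / 2 = \sum_(i < k) (1 / 2) :> R.
      by rewrite sumr_const card_ord -[RHS]mulr_natl mul1r.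
    rewrite -sumrB; apply: ler_sum => i _.
    by apply: half_weight_excess => //; lra.
  have : (1 - 2 * d) * (1 / 2) <= (1 - 2 * d) * \sum_i excess b i.
    by rewrite ler_wpM2l //; lra.
  by rewrite /S; lra.
right.
(* [c = s - d] is the positive root of [c^2 + 2 c d = 1]; it is at most [1/2] because [d >= 3/4]. *)
set s := Num.sqrt (d ^+ 2 + 1).
have s0 : 0 <= s by apply: sqrtr_ge0.
have sE : s ^+ 2 = d ^+ 2 + 1 by rewrite sqr_sqrtr // addr_ge0 ?sqr_ge0.
have ds : d < s by rewrite -(ltr_pXn2r (n := 2)) ?nnegrE // sE; lra.
have sd : s <= d + 1 / 2 by rewrite -(ler_pXn2r (n := 2)) ?nnegrE ?sE //; nra.
have cE : (s - d) ^+ 2 + 2 * (s - d) * d = 1.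
  by rewrite -[RHS](addKr (d ^+ 2)) -sE; ring.
have hS : d + k%:R * (s - d) <= S by apply: halfS; lra.
(* The inequality of arithmetic and geometric means, for [1] and [(2 k - 1) c^2]; their sum is at
   most [2 c S]. *)
have := sqr_ge0 (1 - (2 * k%:R - 1) * (s - d) ^+ 2).
move: (s - d) cE hS (subr_gt0 d s) => c cE hS; rewrite ds => c0 sq.
have k0 : 0 <= k%:R :> R by [].
have hS2 : 1 + (2 * k%:R - 1) * c ^+ 2 <= 2 * c * S.
  have : 2 * c * (d + k%:R * c) <= 2 * c * S by rewrite ler_pM2l //; lra.
  by lra.
have [k_small|k_big] := lerP (2 * k%:R - 1) (0 : R).
  by apply: le_trans k_small (sqr_ge0 _).
have lhs0 : 0 <= 1 + (2 * k%:R - 1) * c ^+ 2.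
  by rewrite addr_ge0 // mulr_ge0 ?sqr_ge0 // ltW.
have : (1 + (2 * k%:R - 1) * c ^+ 2) ^+ 2 <= (2 * c * S) ^+ 2.
  by rewrite ler_pXn2r ?nnegrE //; apply: le_trans hS2.
have c2 : 0 < c ^+ 2 by rewrite exprn_gt0.
by move=> h; rewrite -(ler_pM2l c2); lra.
Qed.

Lemma f_ge0 (R : realType) (k : nat) : (0 < k)%N -> 0 <= f R k.
Proof.
move=> k0; rewrite /f; case: ifP => _; first by rewrite invr_ge0 exprn_ge0.
have k1 : 1 <= k%:R :> R by rewrite ler1n.
by rewrite invr_ge0; lra.
Qed.

(** [f R k] is the inverse of the smaller of [(uphalf k)^2] and [2 k - 1]: the former is smaller or
    equal for [k <= 6], the latter for [k >= 7]. *)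
Lemma f_ge_invsq (R : realType) (k : nat) (S : R) :
    (0 < k)%N -> 0 <= S -> (uphalf k)%:R <= S \/ 2 * k%:R - 1 <= S ^+ 2 ->
  1 <= f R k * S ^+ 2.
Proof.
move=> k0 S0 hS; rewrite /f.
have k1 : 1 <= k%:R :> R by rewrite ler1n.
have u1 : 1 <= (uphalf k)%:R :> R by rewrite ler1n uphalf_gt0.
have uk : k%:R / 2 <= (uphalf k)%:R :> R.
  by rewrite natr_uphalf; have := ler0n R (odd k); lra.
case: leqP => k6.
  rewrite mulrC ler_pdivlMr ?exprn_gt0 ?mul1r //; last by lra.
  case: hS => [uS|]; first by rewrite ler_pXn2r ?nnegrE //; lra.
  apply: le_trans.
  by case: k k0 k6 {k1 u1 uk} => [|[|[|[|[|[|[|]]]]]]] //= _ _; lra.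
rewrite mulrC ler_pdivlMr ?mul1r //; last by lra.
case: hS => // uS.
have : (uphalf k)%:R ^+ 2 <= S ^+ 2 by rewrite ler_pXn2r ?nnegrE //; lra.
apply: le_trans.
(* For [k = 7] the rounding up matters, as [49/4 < 13 <= 16]; from [8] on, [k^2 / 4 >= 2 k - 1]. *)
have [->|k7] := eqVneq k 7; first by rewrite /=; lra.
have : 8 <= k%:R :> R by rewrite ler_nat; lia.
by nra.
Qed.

(** The homogeneous form of [total_weight_ge]: all weights are divided by the square root of [T]. *)
Lemma weights_le_f (R : realType) (k : nat) (a : 'I_k -> R)
    (b : 'I_k -> 'I_k -> R) (d n T : R) :
    (0 < k)%N ->
    (forall i, 0 <= a i) -> (forall i j, 0 <= b i j) -> 0 <= d ->
    (forall i j, b i j = b j i) -> (forall i, b i i = 0) ->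
    d + \sum_i (a i + (\sum_j b i j) / 2) <= n -> 0 < T ->
    (forall i, T <= a i ^+ 2 + 2 * a i * (\sum_j b i j + d) + \sum_j b i j ^+ 2) ->
  T <= f R k * n ^+ 2.
Proof.
move=> k0 a0 b0 d0 bC bD Sn T0 xT.
have r0 : 0 < Num.sqrt T by rewrite sqrtr_gt0.
have rE : Num.sqrt T ^+ 2 = T by rewrite sqr_sqrtr // ltW.
move: (Num.sqrt T) r0 rE => r r0 rE.
have ri0 : 0 <= r^-1 by rewrite invr_ge0 ltW.
set S := d + _ in Sn.
have S0 : 0 <= S.
  rewrite addr_ge0 // sumr_ge0 // => i _.
  by rewrite addr_ge0 // divr_ge0 // sumr_ge0.
have SE : d / r + \sum_i (a i / r + (\sum_j b i j / r) / 2) = S / r.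
  rewrite mulrDl mulr_suml; congr (_ + _); apply: eq_bigr => i _.
  by rewrite -mulr_suml mulrDl mulrAC.
have := @total_weight_ge R k (fun i => a i / r) (fun i j => b i j / r) (d / r).
rewrite /= SE => hw.
have {}hw : (uphalf k)%:R <= S / r \/ 2 * k%:R - 1 <= (S / r) ^+ 2.
  apply: hw => [i|i j||i j|i|i]; try by rewrite ?mulr_ge0.
  - by rewrite bC.
  - by rewrite bD mul0r.
  rewrite -mulr_suml.
  have -> : \sum_j (b i j / r) ^+ 2 = (\sum_j b i j ^+ 2) / r ^+ 2.
    by rewrite mulr_suml; apply: eq_bigr => j _; rewrite expr_div_n.
  set x := (X in _ <= X).
  have -> : x = (a i ^+ 2 + 2 * a i * (\sum_j b i j + d) + \sum_j b i j ^+ 2) / r ^+ 2.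
    by rewrite /x; field; lra.
  by rewrite ler_pdivlMr ?exprn_gt0 // mul1r rE.
have := f_ge_invsq k0 (mulr_ge0 S0 ri0) hw.
rewrite expr_div_n rE mulrA ler_pdivlMr // mul1r => /le_trans; apply.
by rewrite ler_wpM2l ?f_ge0 // ler_pXn2r ?nnegrE //; lra.
Qed.

(** * Cores and colour types *)

Lemma card_darts (V : finType) (G : sgraph V) :
  #|[set q : V * V | adj G q.1 q.2]| = (2 * #|edges G|)%N.
Proof.
rewrite -sum1_card.
rewrite (partition_big (fun q : V * V => [set q.1; q.2]) (mem (edges G))) /=; last first.
  by move=> q; rewrite inE => Gq; apply/imsetP; exists q.
rewrite (eq_bigr (fun=> 2)) ?sum_nat_const 1?mulnC //.
move=> _ /imsetP[[u v] /= Guv ->]; rewrite inE /= in Guv.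
have uv : u != v by apply: contraTneq Guv => ->; rewrite adj_irrefl.
have nuv : (u, v) != (v, u) by rewrite xpair_eqE negb_and uv.
rewrite sum1_card -[RHS](_ : #|[set (u, v); (v, u)]| = 2); last first.
  by rewrite cards2 nuv.
apply: eq_card => -[x y]; rewrite !inE /= !xpair_eqE unfold_in /= inE /=.
apply/andP/orP => [[Gxy /eqP xyE]|[/andP[/eqP-> /eqP->]|/andP[/eqP-> /eqP->]]].
- have : x \in [set u; v] by rewrite -xyE set21.
  have : y \in [set u; v] by rewrite -xyE set22.
  have xy : x != y by apply: contraTneq Gxy => ->; rewrite adj_irrefl.
  rewrite !inE => /orP[]/eqP yE /orP[]/eqP xE; rewrite xE yE ?eqxx in xy *; by [|left|right].
- by [].
- by rewrite adj_sym setUC.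
Qed.

Definition darts_in (V : finType) (e : rel V) (S : {set V}) : {set V * V} :=
  [set q in setX S S | e q.1 q.2].

(** Vertices with at most two neighbours left are removed one at a time; each removal costs at most
    two darts in either direction. *)
Lemma core_exists (V : finType) (e : rel V) (S : {set V}) :
  symmetric e ->
  exists T : {set V}, (forall v, v \in T -> 2 < #|[set w in T | e v w]|)%N
    /\ (#|darts_in e S| <= #|darts_in e T| + 4 * #|S|)%N.
Proof.
move=> eC; have [n] := ubnP #|S|; elim: n S => // n IH S ltS.
have [/existsP[v /andP[vS degv]]|] :=
    boolP [exists v, (v \in S) && (#|[set w in S | e v w]| <= 2)%N]; last first.
  rewrite negb_exists => /forallP degS; exists S; split; last exact: leq_addr.
  by move=> v vS; have := degS v; rewrite vS /= -ltnNge.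
have cS := cardsD1 v S; rewrite vS add1n in cS.
have [|T [degT le_T]] := IH (S :\ v); first by lia.
exists T; split => //.
pose N := [set w in S | e v w].
have sub : darts_in e S \subset
    darts_in e (S :\ v) :|: (setX [set v] N :|: setX N [set v]).
  apply/subsetP => -[x y]; rewrite /N !inE /= => /andP[/andP[xS yS] xy].
  have [xv|xv] := eqVneq x v; first by rewrite -xv xy yS orbT.
  have [yv|yv] := eqVneq y v; first by rewrite -yv (eC y) xy xS !orbT.
  by rewrite xS yS xy.
have [u1 _] := leq_card_setU (setX [set v] N) (setX N [set v]).
have [u2 _] := leq_card_setU (darts_in e (S :\ v)) (setX [set v] N :|: setX N [set v]).
apply: leq_trans (subset_leq_card sub) (leq_trans u2 _).
rewrite cS mulnS addnCA addnC; apply: leq_add le_T; apply: leq_trans u1 _.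
by rewrite !cardsX cards1 mul1n muln1; apply: (leq_add degv degv).
Qed.

(** Three neighbours in the core are enough to avoid two vertices, so [uv] extends greedily at both
    ends, in colours [j] and [l]. *)
Lemma rainbow_of_cores (k : nat) (V : finType) (G : 'I_k -> sgraph V)
    (T : 'I_k -> {set V}) (u v : V) (i j l : 'I_k) :
    (forall i x, x \in T i -> 2 < #|[set w in T i | adj (G i) x w]|)%N ->
    adj (G i) u v -> j != i -> l != i -> j != l -> u \in T j -> v \in T l ->
  has_rainbow_path3 G.
Proof.
move=> degT Guv ji li jl uT vT.
have uv : u != v by apply: contraTneq Guv => ->; rewrite adj_irrefl.
have avoid h x (Y : {set V}) : x \in T h -> (#|Y| <= 2)%N ->
    exists2 y, adj (G h) x y & y \notin Y.
  move=> xT Y2.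
  have /subsetPn[y] : ~~ ([set w in T h | adj (G h) x w] \subset Y).
    apply/negP => /subset_leq_card; have := degT h x xT; lia.
  by rewrite inE => /andP[_ xy] yY; exists y.
have [|a ua av] := avoid j u [set v] uT; first by rewrite cards1.
have [|b vb bua] := avoid l v [set u; a] vT; first by rewrite cards2; case: (_ != _).
exists a, u, v, b, j, i, l; split => //; last by rewrite adj_sym.
  have au : a != u by apply: contraTneq ua => ->; rewrite adj_irrefl.
  have vnb : v != b by apply: contraTneq vb => ->; rewrite adj_irrefl.
  move: av bua; rewrite !inE negb_or => av /andP[bu ba].
  by rewrite /= !inE !negb_or au av uv vnb !(eq_sym _ b) bu ba.
by rewrite /= !inE !negb_or ji jl eq_sym li.
Qed.

(* The vertices are sorted by the set [CC v] of colours whose core contains [v]. *)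
Definition single_type (k : nat) (V : finType) (CC : V -> {set 'I_k}) i : {set V} :=
  [set v | (i \in CC v) && (#|CC v| == 1)].

Definition double_type (k : nat) (V : finType) (CC : V -> {set 'I_k}) i j : {set V} :=
  [set v | [&& i \in CC v, j \in CC v :\ i & #|CC v| == 2]].

Definition multiple_type (k : nat) (V : finType) (CC : V -> {set 'I_k}) : {set V} :=
  [set v | (2 < #|CC v|)%N].

(** No vertex is counted more than twice; one with exactly two colours appears once for each
    ordering of them. *)
Lemma card_types_le (k : nat) (V : finType) (CC : V -> {set 'I_k}) :
  (2 * #|multiple_type CC|
   + \sum_i (2 * #|single_type CC i| + \sum_j #|double_type CC i j|) <= 2 * #|V|)%N.
Proof.
have cardE (P : pred V) : #|[set v | P v]| = (\sum_v P v)%N.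
  by rewrite -sum1_card big_mkcond; apply: eq_bigr => v _; rewrite inE; case: (P v).
have -> : (2 * #|multiple_type CC|
   + \sum_i (2 * #|single_type CC i| + \sum_j #|double_type CC i j|)
   = \sum_v (2 * (2 < #|CC v|)
     + \sum_i (2 * ((i \in CC v) && (#|CC v| == 1))
       + \sum_j [&& i \in CC v, j \in CC v :\ i & #|CC v| == 2])))%N.
  rewrite [RHS]big_split -big_distrr -cardE; congr (_ + _)%N.
  rewrite [RHS]exchange_big; apply: eq_bigr => i _.
  rewrite [RHS]big_split -big_distrr -cardE; congr (_ + _)%N.
  by rewrite [RHS]exchange_big; apply: eq_bigr => j _; rewrite -cardE.
rewrite -sum1_card big_distrr /=.
apply: leq_sum => v _; rewrite muln1.
have sumb (P : pred 'I_k) (c : bool) : (\sum_i (P i && c) = #|P| * c)%N.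
  rewrite -sum1_card big_distrl [RHS]big_mkcond /=; apply: eq_bigr => i _.
  by rewrite unfold_in; case: (P i); rewrite ?mul1n.
rewrite big_split /= -big_distrr /= (sumb (mem (CC v))).
have -> : (\sum_(i < k) \sum_(j < k) [&& i \in CC v, j \in CC v :\ i & #|CC v| == 2]
    = 2 * (#|CC v| == 2))%N.
  transitivity (\sum_(i in CC v) (#|CC v :\ i| * (#|CC v| == 2)))%N.
    rewrite [RHS]big_mkcond; apply: eq_bigr => i _.
    case: (i \in CC v) => /=; last by rewrite big1.
    exact: (sumb (mem (CC v :\ i))).
  rewrite (eq_bigr (fun=> (#|CC v| == 2) : nat)); last first.
    by move=> i iC; have := cardsD1 i (CC v); rewrite iC; case: eqP => [->|_]; lia.
  by rewrite sum_nat_const; case: eqP => [->|_]; rewrite ?muln0.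
have -> : #|mem (CC v)| = #|CC v| by apply: eq_card.
by case: #|CC v| => [|[|[|c]]] //=; rewrite !muln0.
Qed.

Lemma card_bigcup_le (I V : finType) (F : I -> {set V}) :
  (#|\bigcup_i F i| <= \sum_i #|F i|)%N.
Proof.
elim/big_rec2: _ => [|i n X _ IH]; first by rewrite cards0.
by have [/leq_trans + _] := leq_card_setU (F i) X; apply; rewrite leq_add2l.
Qed.

Lemma card_setU_le (V : finType) (X Y : {set V}) (m n : nat) :
  (#|X| <= m -> #|Y| <= n -> #|X :|: Y| <= m + n)%N.
Proof.
by move=> Xm Yn; have [/leq_trans + _] := leq_card_setU X Y; apply; apply: leq_add.
Qed.

Lemma double_typeC (k : nat) (V : finType) (CC : V -> {set 'I_k}) i j :
  double_type CC i j = double_type CC j i.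
Proof.
apply/setP => v; rewrite !inE (eq_sym j).
by case: (i \in _); case: (j \in _); rewrite ?andbF.
Qed.

Lemma double_type_diag (k : nat) (V : finType) (CC : V -> {set 'I_k}) i :
  double_type CC i i = set0.
Proof. by apply/setP => v; rewrite !inE eqxx andbF. Qed.

Lemma card_core_darts_le (k : nat) (V : finType) (G : 'I_k -> sgraph V)
    (T : 'I_k -> {set V}) (i : 'I_k) :
    (forall i x, x \in T i -> 2 < #|[set w in T i | adj (G i) x w]|)%N ->
    ~ has_rainbow_path3 G ->
  let CC v := [set h | v \in T h] in
  let beta := (\sum_j #|double_type CC i j| + #|multiple_type CC|)%N in
  is_true (#|darts_in (adj (G i)) (T i)|
    <= #|single_type CC i| * #|single_type CC i| + 2 * (#|single_type CC i| * beta)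
       + \sum_j #|double_type CC i j| * #|double_type CC i j|)%N.
Proof.
move=> degT norb CC beta.
pose A := single_type CC i; pose B := double_type CC i.
pose X := (\bigcup_j B j) :|: multiple_type CC.
have cX : (#|X| <= beta)%N by apply: card_setU_le => //; apply: card_bigcup_le.
have typeP v : v \in T i -> v \in A \/ exists2 j, j != i & v \in T j.
  move=> vT; have vC : i \in CC v by rewrite inE.
  rewrite inE vC /=; have := cardsD1 i (CC v); rewrite vC add1n => cE.
  have [C0|[j jC]] := set_0Vmem (CC v :\ i); first by left; rewrite cE C0 cards0.
  by right; exists j; move: jC; rewrite !inE => /andP[].
have inX v j : v \in T i -> j != i -> v \in T j -> v \in X.
  move=> vT ji vj; have vC : i \in CC v by rewrite inE.
  have jC : j \in CC v :\ i by rewrite !inE ji.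
  have := cardsD1 i (CC v); have := cardsD1 j (CC v :\ i); rewrite vC jC !add1n => -> cE.
  rewrite inE; case c2: (#|CC v| == 2).
    by apply/orP; left; apply/bigcupP; exists j => //; rewrite inE vC jC c2.
  by apply/orP; right; move: c2; rewrite inE cE; case: #|_|.
(* [X] contains the core vertices that have a further colour. A dart either has an end in [A], or
   has both ends in the same [B j]. *)
have sub : darts_in (adj (G i)) (T i) \subset
    (setX A A :|: (setX A X :|: setX X A)) :|: \bigcup_j setX (B j) (B j).
  apply/subsetP => -[u v]; rewrite inE in_setX /= => /andP[/andP[uT vT] uv].
  rewrite in_setU in_setU in_setU !in_setX.
  have [uA|[j ji uj]] := typeP u uT.
    have [->|[l li vl]] := typeP v vT; first by rewrite uA.
    by rewrite uA (inX v l vT li vl) !orbT.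
  have [vA|[l li vl]] := typeP v vT.
    by rewrite vA (inX u j uT ji uj) !orbT.
  (* Distinct further colours at the two ends would make [uv] the middle edge of a rainbow path.
     Hence each end has exactly one further colour, the same for both. *)
  have same x y : x != i -> y != i -> u \in T x -> v \in T y -> x = y.
    move=> xi yi ux vy; apply/eqP/negPn/negP => xy; apply: norb.
    exact: rainbow_of_cores degT uv xi yi xy ux vy.
  have jl := same j l ji li uj vl; rewrite -jl in vl.
  have two w : w \in T i -> w \in T j ->
      (forall x, x != i -> w \in T x -> x = j) -> w \in B j.
    move=> wT wj wu; have CE : CC w = [set i; j].
      apply/setP => x; rewrite !inE; have [->//|xi] := eqVneq x i.
      by apply/idP/eqP => [|->//]; apply: wu.
    by rewrite inE CE !inE eqxx ji eqxx cards2 eq_sym ji orbT.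
  apply/orP; right; apply/bigcupP; exists j => //; rewrite in_setX.
  rewrite !two // => x xi => [vx|ux]; first by rewrite -(same j x).
  by rewrite (same x j).
apply: leq_trans (subset_leq_card sub) _.
apply: card_setU_le; last first.
  by apply: leq_trans (card_bigcup_le _) _; apply: leq_sum => j _; rewrite cardsX.
apply: card_setU_le; first by rewrite cardsX.
rewrite mul2n -addnn; apply: card_setU_le; rewrite cardsX ?[(#|X| * _)%N]mulnC.
  by rewrite leq_mul2l cX orbT.
by rewrite leq_mul2l cX orbT.
Qed.

Lemma edges_of_no_rainbow (R : realType) (k : nat) (V : finType)
    (G : 'I_k -> sgraph V) (E : R) :
    (0 < k)%N -> ~ has_rainbow_path3 G -> (forall i, E <= #|edges (G i)|%:R) ->
  2 * E <= f R k * #|V|%:R ^+ 2 + 4 * #|V|%:R.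
Proof.
move=> k0 norb leE.
have [T degT leT] : exists2 T : 'I_k -> {set V},
    (forall i x, x \in T i -> 2 < #|[set w in T i | adj (G i) x w]|)%N
  & forall i, (2 * #|edges (G i)| <= #|darts_in (adj (G i)) (T i)| + 4 * #|V|)%N.
  have /fin_all_exists[T HT] : forall i, exists Ti : {set V},
      (forall x, x \in Ti -> 2 < #|[set w in Ti | adj (G i) x w]|)%N
      /\ (2 * #|edges (G i)| <= #|darts_in (adj (G i)) Ti| + 4 * #|V|)%N.
    move=> i; have [Ti [degTi leTi]] := core_exists setT (@adj_sym _ (G i)).
    exists Ti; split => //; rewrite -card_darts -[#|V|]cardsT; apply: leq_trans leTi.
    by apply: subset_leq_card; apply/subsetP => q; rewrite !inE.
  by exists T => i; have [] := HT i.
pose CC v := [set h | v \in T h].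
have types := card_types_le CC.
have core i := card_core_darts_le i degT norb.
rewrite /= -/CC in core.
set n := #|V|%:R : R.
have n0 : 0 <= n by [].
(* [weights_le_f] needs a positive [T], here [2 E - 4 n]; otherwise the bound is immediate. *)
have [|E0] := lerP (2 * E - 4 * n) 0.
  by have := mulr_ge0 (f_ge0 R k0) (sqr_ge0 n); lra.
suff : 2 * E - 4 * n <= f R k * n ^+ 2 by lra.
apply: (@weights_le_f _ _ (fun i => #|single_type CC i|%:R)
  (fun i j => #|double_type CC i j|%:R) #|multiple_type CC|%:R) => //.
- by move=> i j; rewrite double_typeC.
- by move=> i; rewrite double_type_diag cards0.
- rewrite -(ler_pM2l (_ : 0 < 2 :> R)) // -(natrM _ 2 #|V|).
  apply: le_trans (_ : (2 * #|V|)%N%:R <= _); last by [].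
  move: types; rewrite -(ler_nat R); apply: le_trans.
  rewrite natrD natrM mulrDr lerD2l natr_sum mulr_sumr; apply: ler_sum => i _.
  by rewrite natrD natrM natr_sum; lra.
move=> i; have := core i; rewrite -(ler_nat R).
rewrite !natrD !natrM !natrD !natr_sum => core_i.
have := leT i; rewrite -(ler_nat R) natrD !natrM -/n => leTi.
have -> : \sum_j #|double_type CC i j|%:R ^+ 2
    = \sum_j (#|double_type CC i j| * #|double_type CC i j|)%:R :> R.
  by apply: eq_bigr => j _; rewrite natrM expr2.
by have := leE i; lra.
Qed.

(** * Extremal graphs *)

(* Vertices are split evenly into residue classes mod [M]; edges join vertices of
   class [c], and class [c] to the classes from [t] on. *)
Definition class_adj (n M t c : nat) : rel 'I_n :=
  [rel u v : 'I_n | [&& u != v, (u %% M == c) || (v %% M == c),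
      (u %% M == c) || (t <= u %% M) & (v %% M == c) || (t <= v %% M)]]%N.

Lemma class_adj_sym n M t c : symmetric (@class_adj n M t c).
Proof. by move=> u v; rewrite /class_adj /= eq_sym orbC [X in _ && (_ && X)]andbC. Qed.

Lemma class_adj_irrefl n M t c : irreflexive (@class_adj n M t c).
Proof. by move=> u; rewrite /class_adj /= eqxx. Qed.

Definition class_graph (n M t c : nat) : sgraph 'I_n :=
  SGraph (@class_adj_sym n M t c) (@class_adj_irrefl n M t c).

Lemma class_adj_class (n M t c : nat) (u v : 'I_n) :
  class_adj M t c u v -> (u %% M < t)%N -> (u %% M = c)%N.
Proof. by move=> /and4P[_ _ /orP[/eqP//|]]; rewrite ltnNge => ->. Qed.

(** The first [n %/ M] blocks of [M] consecutive vertices each contain every residue once. *)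
Lemma card_residues (n M : nat) (Q : pred nat) :
  (n %/ M * #|[set r : 'I_M | Q r]| <= #|[set v : 'I_n | Q (v %% M)]|)%N.
Proof.
case: n => [|n]; first by rewrite div0n.
pose g (x : 'I_(n.+1 %/ M) * 'I_M) : 'I_n.+1 := inord (x.1 * M + x.2).
have gE x : g x = (x.1 * M + x.2)%N :> nat.
  rewrite inordK //; case: x => q r /=.
  apply: leq_trans (leq_divM n.+1 M).
  have : (q * M + r < q.+1 * M)%N by rewrite mulSn addnC ltn_add2r.
  by move/leq_trans; apply; rewrite leq_mul2r ltn_ord orbT.
have gM x : (g x %% M = x.2)%N by rewrite gE modnMDl modn_small.
have g_inj : injective g.
  move=> x y xy; have M0 : (0 < M)%N by apply: leq_ltn_trans (ltn_ord x.2).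
  have gd z : (g z %/ M = z.1)%N by rewrite gE divnMDl // (divn_small (ltn_ord z.2)) addn0.
  case: x y xy => x1 x2 [y1 y2] xy; congr pair; apply: val_inj => /=.
    by rewrite -(gd (x1, x2)) xy gd.
  by rewrite -(gM (x1, x2)) xy gM.
rewrite -{1}(card_ord (n.+1 %/ M)) -cardsT -cardsX -(card_imset _ g_inj).
by apply: subset_leq_card; apply/subsetP => _ /imsetP[x + ->]; rewrite !inE gM.
Qed.

(** With [S] the class [c] and [B] the union of the classes from [t] on, all of [S * S], [S * B] and
    [B * S] are darts except for the diagonal of [S]. The term [n %/ M] accounts for that
    diagonal. *)
Lemma class_graph_darts (n M t c : nat) :
    (c < t)%N -> (t <= M)%N ->
  ((2 * (M - t) + 1) * (n %/ M * (n %/ M))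
    <= 2 * #|edges (class_graph n M t c)| + n %/ M)%N.
Proof.
move=> ct tM; set m := (n %/ M)%N; rewrite -card_darts.
set D := [set q | _].
pose S := [set v : 'I_n | v %% M == c]%N.
pose B := [set v : 'I_n | t <= v %% M]%N.
have mS : (m <= #|S|)%N.
  have := card_residues n M (fun r => r == c); apply: leq_trans.
  rewrite -/m -{1}[m]muln1 leq_mul2l; apply/orP; right.
  by apply/card_gt0P; exists (Ordinal (leq_trans ct tM)); rewrite inE.
have mB : (m * (M - t) <= #|B|)%N.
  have := card_residues n M (fun r => t <= r)%N; apply: leq_trans.
  rewrite -/m leq_mul2l; apply/orP; right.
  have h (i : 'I_(M - t)) : (t + i < M)%N by rewrite -ltn_subRL.
  have inj : injective (fun i : 'I_(M - t) => Ordinal (h i)).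
    by move=> i j [/addnI] /val_inj.
  rewrite -{1}[(M - t)%N]card_ord -cardsT -(card_imset _ inj).
  by apply: subset_leq_card; apply/subsetP => _ /imsetP[i _ ->]; rewrite inE leq_addr.
have SB u : u \in S -> u \notin B by rewrite !inE -ltnNge => /eqP->.
have disj1 : [disjoint setX S S & setX S B :|: setX B S].
  rewrite -setI_eq0; apply/eqP/setP => -[u v].
  rewrite in_set0 in_setI in_setU !in_setX /=; apply/negP.
  move=> /andP[/andP[uS vS] /orP[]/andP[]]; first by rewrite (negbTE (SB v vS)).
  by rewrite (negbTE (SB u uS)).
have disj2 : [disjoint setX S B & setX B S].
  rewrite -setI_eq0; apply/eqP/setP => -[u v].
  rewrite in_set0 in_setI !in_setX /=; apply/negP.
  by move=> /andP[/andP[uS _] /andP[]]; rewrite (negbTE (SB u uS)).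
have diag : #|[set (u, u) | u in S]| = #|S| by rewrite card_imset // => u v [].
have sub : setX S S :|: (setX S B :|: setX B S) \subset D :|: [set (u, u) | u in S].
  apply/subsetP => -[u v]; rewrite 3!in_setU !in_setX /= => uv.
  have [uvE|nuv] := eqVneq u v.
    rewrite -uvE in uv *; apply/orP; right; apply: imset_f.
    have [//|uS] := boolP (u \in S); move: uv.
    by rewrite (negbTE uS) /= andbF.
  apply/orP; left; move: uv; rewrite /D !inE /= /class_adj /= nuv.
  by case: (u %% M == c)%N; case: (v %% M == c)%N; case: (t <= u %% M)%N;
    case: (t <= v %% M)%N.
have := subset_leq_card sub.
rewrite cardsU (eqP (_ : _ :&: _ == set0)) ?setI_eq0 // cards0 subn0.
rewrite cardsU (eqP (_ : _ :&: _ == set0)) ?setI_eq0 // cards0 subn0 !cardsX.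
have [+ _] := leq_card_setU D [set (u, u) | u in S]; rewrite diag => h1 h2.
have h3 := leq_trans h2 h1.
move: h3 mS mB; move: (#|S|) (#|B|) (#|D|) => s b x h3 mS mB.
have : (m * (m * (M - t)) <= s * b)%N by apply: leq_mul.
have [m0|m0] := posnP m; first by rewrite m0; lia.
(* [S] may have more than [m] vertices; [x^2 - x] is monotone on the naturals. *)
have : (m * m + s <= s * s + m)%N by nia.
by nia.
Qed.

Lemma class_edges_ge (R : realType) (M t : nat) (delta : R) :
    (0 < M)%N -> (t <= M)%N -> 0 < delta ->
  exists n0 : nat, forall n c : nat, (n0 <= n)%N -> (c < t)%N ->
    ((2 * (M - t) + 1)%N%:R / M%:R ^+ 2 - delta) * (n%:R ^+ 2 / 2)
      <= #|edges (class_graph n M t c)|%:R :> R.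
Proof.
move=> M0 tM delta0.
set K : R := (2 * (M - t) + 1)%N%:R.
have MR : 0 < M%:R :> R by rewrite ltr0n.
have K0 : 0 <= K by [].
set F := K / M%:R ^+ 2.
have F0 : 0 <= F by rewrite divr_ge0 ?exprn_ge0.
have x0 : 0 <= (2 * F * M%:R + 1) / delta.
  by apply: divr_ge0 (ltW delta0); have := mulr_ge0 F0 (ltW MR); lra.
(* Rounding [n] down to a multiple of [M] costs at most [2 F M n], the diagonal at most [n]; for
   these [n] the total is at most [delta n^2]. *)
exists (Num.bound ((2 * F * M%:R + 1) / delta)) => n c n0n ct.
have dn : 2 * F * M%:R + 1 <= delta * n%:R.
  rewrite [leRHS]mulrC -ler_pdivrMr //; apply: le_trans (ltW (archi_boundP x0)) _.
  by rewrite ler_nat.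
have := class_graph_darts n ct tM.
rewrite /= -(ler_nat R) natrD !natrM -/K.
set e : R := #|_|%:R.
have mn : (n %/ M)%:R * M%:R <= n%:R :> R by rewrite -natrM ler_nat leq_divM.
have nm : n%:R <= (n %/ M)%:R * M%:R + M%:R :> R.
  rewrite -natrM -natrD ler_nat {1}(divn_eq n M) leq_add2l.
  by apply: ltnW; rewrite ltn_pmod.
have m_n : (n %/ M)%:R <= n%:R :> R by rewrite ler_nat leq_div.
have KE : K = F * M%:R ^+ 2 by rewrite /F; field; lra.
have mge0 : 0 <= (n %/ M)%:R :> R by [].
have n_ge0 : 0 <= n%:R :> R by [].
move: ((n %/ M)%:R) (n%:R) (M%:R) e MR dn mn nm m_n KE mge0 n_ge0 => m N MM e MR dn mn nm m_n -> mge0 N0 h.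
have sq : N ^+ 2 - 2 * N * MM <= (m * MM) ^+ 2 by nra.
have : F * (N ^+ 2 - 2 * N * MM) <= F * (m * MM) ^+ 2 by rewrite ler_wpM2l.
have : N * (2 * F * MM + 1) <= N * (delta * N) by rewrite ler_wpM2l.
by lra.
Qed.

(** An end of the middle edge lies in class [g i2 < t], and the outer edge at that end must then
    have the same class. If [M <= t], every edge stays inside its class, so all three classes
    agree. *)
Lemma class_rainbow (k n M t : nat) (g : 'I_k -> nat) :
    (forall i, g i < t)%N ->
    has_rainbow_path3 (fun i => class_graph n M t (g i)) ->
  (exists i j, i != j /\ g i = g j) /\
  ((M <= t)%N -> (0 < M)%N ->
    exists i j l, [/\ uniq [:: i; j; l], g i = g j & g j = g l]).
Proof.
move=> gt [v0 [v1 [v2 [v3 [i1 [i2 [i3 [_ uniq_i e1 e2 e3]]]]]]]].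
have {}e1 : class_adj M t (g i1) v1 v0 by rewrite class_adj_sym.
have e2' : class_adj M t (g i2) v2 v1 by rewrite class_adj_sym.
have v1E := class_adj_class e1; have v2E := class_adj_class e3.
have := uniq_i; rewrite /= !inE negb_or andbT => /andP[/andP[i12 _] i23].
split=> [|Mt M0].
  have /and4P[_ /orP[]/eqP vE _ _] := e2.
    by exists i1, i2; rewrite -v1E vE.
  by exists i2, i3; rewrite -v2E vE.
have lt v : (v %% M < t)%N by apply: leq_trans Mt; rewrite ltn_pmod.
exists i1, i2, i3; split => //; first by rewrite -v1E // -(class_adj_class e2).
by rewrite -(class_adj_class e2') // v2E.
Qed.

Theorem theorem1 (R : realType) :
  (forall eps : R, 0 < eps ->
    exists n0 : nat, forall n : nat, (n0 <= n)%N ->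
    forall k : nat, (1 <= k)%N ->
    forall (V : finType), #|V| = n ->
    forall G : 'I_k -> sgraph V,
      (forall i : 'I_k,
         (f R k + eps) * (n%:R ^+ 2 / 2) <= #|edges (G i)|%:R) ->
      has_rainbow_path3 G)
  /\
  (forall k : nat, (1 <= k)%N ->
    forall delta : R, 0 < delta ->
    exists n0 : nat, forall n : nat, (n0 <= n)%N ->
    exists (V : finType) (G : 'I_k -> sgraph V),
      [/\ #|V| = n,
          forall i : 'I_k,
            (f R k - delta) * (n%:R ^+ 2 / 2) <= #|edges (G i)|%:R
        & ~ has_rainbow_path3 G]).
Proof.
split.
(* Once [n > 4 / eps], the surplus [eps n^2] exceeds the [4 n] darts lost in passing to cores. The
   successor makes [n] positive. *)
- move=> eps eps0; exists (Num.bound (4 / eps)).+1 => n n0n k k0 V Vn G leG.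
  apply: boolp.contrapT => norb.
  have := edges_of_no_rainbow k0 norb leG; rewrite Vn.
  have e4 : 0 <= 4 / eps by rewrite divr_ge0 // ltW.
  have nR : 4 / eps < n%:R.
    apply: lt_le_trans (archi_boundP e4) _.
    by rewrite ler_nat; apply: ltnW.
  rewrite ltr_pdivrMr // in nR.
  have n_gt0 : 0 < n%:R :> R by rewrite ltr0n; apply: leq_trans n0n.
  have : n%:R * 4 < n%:R * (n%:R * eps) by rewrite ltr_pM2l.
  by lra.
move=> k k0 delta delta0; have [k6|k7] := leqP k 6.
  have h0 : (0 < uphalf k)%N by rewrite uphalf_gt0.
  have [n0 Hn0] := class_edges_ge h0 (leqnn _) delta0.
  (* Halving pairs consecutive colours, so no clique serves three of them. *)
  have gt (i : 'I_k) : (i./2 < uphalf k)%N by have := ltn_ord i; lia.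
  exists n0 => n n0n.
  exists 'I_n, (fun i => class_graph n (uphalf k) (uphalf k) i./2).
  split; first exact: card_ord.
    by move=> i; have := Hn0 n i./2 n0n (gt i); rewrite /f k6 subnn muln0 add0n div1r.
  move=> /(class_rainbow gt)[_ /(_ (leqnn _) h0)[i [j [l [ijl ij jl]]]]].
  move: ijl; rewrite /= !inE negb_or andbT -!val_eqE => /andP[/andP[/eqP + /eqP +] /eqP +].
  by move: ij jl => /=; lia.
have M0 : (0 < 2 * k - 1)%N by lia.
have tM : (k <= 2 * k - 1)%N by lia.
have [n0 Hn0] := class_edges_ge M0 tM delta0.
exists n0 => n n0n.
(* With [M = 2 k - 1] and [t = k], [2 (M - t) + 1 = M], so the density is [M / M^2 = f R k];
   distinct colours have distinct classes below [t]. *)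
exists 'I_n, (fun i => class_graph n (2 * k - 1) k i).
split; first exact: card_ord.
  move=> i; have := Hn0 n i n0n (ltn_ord i); rewrite /f leqNgt k7 /=.
  rewrite (_ : 2 * (2 * k - 1 - k) + 1 = 2 * k - 1)%N; last by lia.
  rewrite natrB ?natrM; last by lia.
  have k1 : 1 <= k%:R :> R by rewrite ler1n.
  set x := 2 * _ - 1; have x0 : 0 < x by rewrite /x; lra.
  by have -> : x / x ^+ 2 = x^-1 by field; rewrite lt0r_neq0.
move=> /(class_rainbow (@ltn_ord k))[[i [j [ij /val_inj ijE]]] _].
by rewrite ijE eqxx in ij.
Qed.
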